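(* Let $r\ge 2$ and $n\ge 1$ be integers. The action of $G(r,1,n)=\mathbb{Z}/r\mathbb{Z}\wr S_n$ on $B(r,n)=\{(b_i\mid 1\le i\le n)\mid 0\le b_i\le r-1\}$ given by $$x\,(b_i\mid 1\le i\le n)=(x_i+b_{\sigma^{-1}(i)} \pmod r\mid 1\le i\le n),\qquad x=(x_1,\dots,x_n;\sigma)\in G(r,1,n),$$ is transitive.
   Context: $S_n$ is the symmetric group on $\{1,\dots,n\}$. Elements of the wreath product (complex reflection group) $G(r,1,n)=\mathbb{Z}/r\mathbb{Z}\wr S_n$ are written $(x_1,\dots,x_n;\sigma)$ with $x_i\in\mathbb{Z}/r\mathbb{Z}$, $\sigma\in S_n$, and multiplication is $(x_1,\dots,x_n;\sigma)(y_1,\dots,y_n;\tau)=(x_1+y_{\sigma^{-1}(1)},\dots,x_n+y_{\sigma^{-1}(n)};\sigma\tau)$. The set $B(r,n)$ consists of $n$-tuples of integers in $\{0,\dots,r-1\}$, where $\{0,\dots,r-1\}$ is identified with $\mathbb{Z}/r\mathbb{Z}$. *)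

(* Defs.v *)
From HB Require Import structures.
From mathcomp Require Import all_boot all_algebra all_fingroup.

Set Implicit Arguments.
Unset Strict Implicit.
Unset Printing Implicit Defensive.

Import GRing.Theory.

(* The library's [action] is a right action, to x (g * h) = to (to x g) h,
   whereas the action considered here is a left one. *)
Record left_action (gT : finGroupType) (T : Type) := LeftAction {
  lact :> gT -> T -> T;
  lact1 : forall b, lact 1%g b = b;
  lactM : forall g h b, lact (g * h)%g b = lact g (lact h b)
}.

Definition lact_transitive (gT : finGroupType) (T : Type)
    (to : left_action gT T) : Prop :=
  forall b c : T, exists g : gT, to g b = c.

(* G(r,1,n), with indices running over 0, ..., n-1. Only meaningful for r >= 2,
   since 'Z_0 and 'Z_1 are both Z/2Z. *)
Record wreath (r n : nat) := Wreath {
  wvec : {ffun 'I_n -> 'Z_r};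
  wperm : 'S_n
}.

Section WreathGroup.
Variables r n : nat.
Implicit Types x y z : wreath r n.

Definition wreath_pair x := (wvec x, wperm x).
Definition pair_wreath (p : {ffun 'I_n -> 'Z_r} * 'S_n) := Wreath p.1 p.2.

Lemma wreath_pairK : cancel wreath_pair pair_wreath.
Proof. by case. Qed.

HB.instance Definition _ := Finite.copy (wreath r n) (can_type wreath_pairK).

Definition wreath_one : wreath r n := Wreath [ffun=> 0%R] 1%g.

(* The product of 'S_n is (s * t) i = t (s i), so the composite "sigma tau"
   (apply tau first) is written (wperm y * wperm x). *)
Definition wreath_mul x y : wreath r n :=
  Wreath [ffun i => wvec x i + wvec y ((wperm x)^-1%g i)]%R
         (wperm y * wperm x)%g.

Definition wreath_inv x : wreath r n :=
  Wreath [ffun i => - wvec x (wperm x i)]%R (wperm x)^-1%g.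

Lemma wreath_mulA : associative wreath_mul.
Proof.
move=> [x s] [y t] [z u]; rewrite /wreath_mul /=; congr Wreath; last first.
  by rewrite mulgA.
by apply/ffunP=> i; rewrite !ffunE /= invMg permM addrA.
Qed.

Lemma wreath_mul1 : left_id wreath_one wreath_mul.
Proof.
move=> [x s]; rewrite /wreath_mul /=; congr Wreath; last by rewrite mulg1.
by apply/ffunP=> i; rewrite !ffunE /= invg1 perm1 add0r.
Qed.

Lemma wreath_mulV : left_inverse wreath_one wreath_inv wreath_mul.
Proof.
move=> [x s]; rewrite /wreath_mul /=; congr Wreath; last by rewrite mulgV.
by apply/ffunP=> i; rewrite !ffunE /= invgK addNr.
Qed.

HB.instance Definition _ := Finite_isGroup.Build (wreath r n)
  wreath_mulA wreath_mul1 wreath_mulV.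

End WreathGroup.

(* B(r,n): n-tuples of integers in {0, ..., r-1} *)
Definition Brn (r n : nat) := {ffun 'I_n -> 'I_r}.

(* (a + b) mod r; the existence of b gives r > 0. *)
Definition addmod (r : nat) (a : nat) (b : 'I_r) : 'I_r :=
  Ordinal (ltn_pmod (a + b) (leq_ltn_trans (leq0n b) (ltn_ord b))).

Definition wreath_act (r n : nat) (x : wreath r n) (b : Brn r n) : Brn r n :=
  [ffun i => addmod (wvec x i) (b ((wperm x)^-1%g i))].

Lemma wreath_act1 (r n : nat) (b : Brn r n) : wreath_act 1%g b = b.
Proof.
have -> : 1%g = wreath_one r n by [].
apply/ffunP=> i; apply: val_inj.
by rewrite !ffunE /= invg1 perm1 add0n modn_small.
Qed.

Lemma wreath_actM (r n : nat) (x y : wreath r n) (b : Brn r n) :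
  wreath_act (x * y)%g b = wreath_act x (wreath_act y b).
Proof.
have -> : (x * y)%g = wreath_mul x y by [].
apply/ffunP=> i; apply: val_inj.
rewrite !ffunE /= invMg permM.
move: (wvec x i) (wvec y _) (b _) => {x y b i} a c.
by case: r a c => [|[|r]] a c d /=; [case: d | rewrite !modn1
  | rewrite modnDml modnDmr addnA].
Qed.

Definition wreath_action (r n : nat) : left_action (wreath r n) (Brn r n) :=
  LeftAction (@wreath_act1 r n) (@wreath_actM r n).

(* Main.v *)
Require Import Defs.
From mathcomp Require Import all_boot all_algebra all_fingroup.

Theorem proposition2p1 (r n : nat) (hr : 2 <= r) (hn : 1 <= n) :
  lact_transitive (wreath_action r n).
Proof.
case: r hr => [|[|r]] // _ b c.
(* Translations alone suffice: with trivial permutation, shift each coordinate by [c i - b i] modulo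
   [r.+2]. Adding [r.+2] first keeps the natural-number subtraction from truncating, since
   [b i < r.+2]. *)
exists (@Wreath r.+2 n [ffun i => inZp (c i + (r.+2 - b i))] 1%g).
apply/ffunP => i; apply: val_inj; rewrite !ffunE /= invg1 perm1.
by rewrite modnDml -addnA subnK ?(ltnW (ltn_ord _)) // modnDr modn_small.
Qed.
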